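(* 1. Let $G,H$ be finite simple graphs. Then $G$ and $H$ have the same s-homotopy type if and only if the simplicial complexes $\Delta_{\mathscr G}(G)$ and $\Delta_{\mathscr G}(H)$ have the same simple-homotopy type. 2. Let $K,L$ be finite (abstract) simplicial complexes. Then $K$ and $L$ have the same simple-homotopy type if and only if the graphs $\Gamma(K)$ and $\Gamma(L)$ have the same s-homotopy type.
   Context: All graphs are finite, undirected, without loops or multiple edges, and are considered up to isomorphism. For a vertex $g$ of $G$, $N_G(g)$ is the set of neighbours of $g$ and $N_G[g]=N_G(g)\cup\{g\}$; a set of vertices is identified with the subgraph it induces. A vertex $g$ is dominated by a vertex $g'\neq g$ if $N_G[g]\subseteq N_G[g']$. A graph $G$ is dismantlable if it has exactly one vertex, or if its vertices can be listed $g_1,\dots,g_n$ ($n\ge 2$) so that for each $2\le i\le n$, $g_i$ is dominated by some other vertex in the subgraph induced by $\{g_1,\dots,g_i\}$ (in particular a dismantlable graph is nonempty). A vertex $g$ of $G$ is s-dismantlable if the induced subgraph $N_G(g)$ is dismantlable. Two graphs $G,H$ have the same s-homotopy type if there is a finite sequence $G=J_1,\dots,J_k=H$ where each $J_{i+1}$ is obtained from $J_i$ either by deleting a vertex that is s-dismantlable in $J_i$, or by adding a new vertex $x$ (with some edges to $J_i$) such that $x$ is s-dismantlable in $J_{i+1}$. For a graph $G$, $\Delta_{\mathscr G}(G)$ is the simplicial complex on vertex set $V(G)$ whose simplices are the vertex sets of nonempty complete subgraphs of $G$. For a simplicial complex $K$, $\Gamma(K)$ is the graph whose vertices are the (nonempty)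 simplices of $K$, two distinct simplices being adjacent iff one is contained in the other. An elementary collapse of $K$ removes a pair $(\sigma,\tau)$ of simplices where $\tau\subset\sigma$, $\tau$ has exactly one vertex fewer than $\sigma$, and $\sigma$ is the only simplex of $K$ properly containing $\tau$; an elementary expansion is the inverse operation. Two complexes have the same simple-homotopy type if one can be transformed into the other by a finite sequence of elementary collapses and expansions. *)

(* Defs.v *)
From mathcomp Require Import all_boot.
Set Implicit Arguments.
Unset Strict Implicit.
Unset Printing Implicit Defensive.

Record sgraph := SGraph {
  svertex :> finType;
  adj : rel svertex;
  adj_sym : symmetric adj;
  adj_irrefl : irreflexive adj }.

Definition graph_iso (G H : sgraph) : Prop :=
  exists2 f : G -> H, bijective f & forall x y, adj (f x) (f y) = adj x y.

Section Induced.
Variables (G : sgraph) (A : {set G}).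

Definition induced_adj : rel {x : G | x \in A} :=
  fun u v => adj (val u) (val v).

Lemma induced_adj_sym : symmetric induced_adj.
Proof. by move=> u v; apply: adj_sym. Qed.

Lemma induced_adj_irrefl : irreflexive induced_adj.
Proof. by move=> u; apply: adj_irrefl. Qed.

Definition induced : sgraph := SGraph induced_adj_sym induced_adj_irrefl.

End Induced.

Definition open_nbh (G : sgraph) (g : G) : {set G} := [set x | adj g x].
Definition closed_nbh (G : sgraph) (g : G) : {set G} := g |: open_nbh g.

(* Domination of g by g' in the subgraph induced by A, where the closed       *)
(* neighbourhood of x is closed_nbh x :&: A.                                  *)
Definition dominated_in (G : sgraph) (A : {set G}) (g g' : G) : bool :=
  [&& g \in A, g' \in A, g' != g &
      closed_nbh g :&: A \subset closed_nbh g' :&: A].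

(* Dismantlability of the subgraph induced by A.  The list s is g_1, ..., g_n *)
(* and p ranges over its prefixes g_1, ..., g_{i-1}, nonempty when i >= 2.    *)
(* The case n = 1 is the one-vertex graph.                                    *)
Definition dismantlable (G : sgraph) (A : {set G}) : Prop :=
  exists s : seq G,
    [/\ s =i A, uniq s, s != [::] &
        forall (p q : seq G) (g : G), s = p ++ g :: q -> p != [::] ->
          exists g' : G, dominated_in [set x in rcons p g] g g'].

Definition s_dismantlable (G : sgraph) (g : G) : Prop :=
  dismantlable (open_nbh g).

Definition s_deletion (G H : sgraph) : Prop :=
  exists2 g : G, s_dismantlable g & graph_iso (induced [set~ g]) H.

(* J arises from G by adding a new vertex x that is s-dismantlable in J       *)
(* exactly when G arises from J by deleting x.                                *)
Definition s_step (G J : sgraph) : Prop := s_deletion G J \/ s_deletion J G.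

Inductive same_s_homotopy_type : sgraph -> sgraph -> Prop :=
| s_homotopy_iso (G H : sgraph) :
    graph_iso G H -> same_s_homotopy_type G H
| s_homotopy_step (G J H : sgraph) :
    s_step G J -> same_s_homotopy_type J H -> same_s_homotopy_type G H.

(* Simplices are nonempty, and every element of the carrier is a vertex, so   *)
(* the empty complex is the one whose carrier is empty.                       *)
Record scomplex := SComplex {
  cvertex :> finType;
  simplices : {set {set cvertex}};
  simplex_neq0 : set0 \notin simplices;
  simplex_sub : forall s t : {set cvertex},
    s \in simplices -> t != set0 -> t \subset s -> t \in simplices;
  simplex_vertex : forall v : cvertex, [set v] \in simplices }.

Definition complex_iso (K L : scomplex) : Prop :=
  exists2 f : K -> L, bijective f &
    forall s : {set K}, (f @: s \in simplices L) = (s \in simplices K).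

Definition free_pair (K : scomplex) (sigma tau : {set K}) : Prop :=
  [/\ sigma \in simplices K, tau \in simplices K, tau \subset sigma,
      #|sigma| = #|tau|.+1 &
      forall rho : {set K}, rho \in simplices K -> tau \proper rho ->
        rho = sigma].

(* L is identified, through f, with the complex left after removing sigma and *)
(* tau from K.  When tau is a single vertex, that vertex leaves the carrier,  *)
(* so f need not be surjective.                                               *)
Definition elementary_collapse (K L : scomplex) : Prop :=
  exists sigma tau : {set K}, free_pair sigma tau /\
    exists2 f : L -> K, injective f &
      [set f @: s | s : {set L} in simplices L] =
        simplices K :\: [set sigma; tau].

Definition simple_step (K L : scomplex) : Prop :=
  elementary_collapse K L \/ elementary_collapse L K.

Inductive same_simple_homotopy_type : scomplex -> scomplex -> Prop :=
| simple_homotopy_iso (K L : scomplex) :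
    complex_iso K L -> same_simple_homotopy_type K L
| simple_homotopy_step (K M L : scomplex) :
    simple_step K M -> same_simple_homotopy_type M L ->
    same_simple_homotopy_type K L.

Section CliqueComplex.
Variable G : sgraph.

Definition complete_set (A : {set G}) : bool :=
  [forall x in A, forall y in A, (x != y) ==> adj x y].

Definition cliques : {set {set G}} :=
  [set A : {set G} | (A != set0) && complete_set A].

Lemma cliques_neq0 : set0 \notin cliques.
Proof. by rewrite inE eqxx. Qed.

Lemma cliques_sub (s t : {set G}) :
  s \in cliques -> t != set0 -> t \subset s -> t \in cliques.
Proof.
rewrite !inE => /andP[_ /forall_inP sP] -> /subsetP ts /=.
apply/forall_inP => x xt; apply/forall_inP => y yt.
by have /forall_inP := sP x (ts x xt); apply; apply: ts.
Qed.

Lemma cliques_vertex (v : G) : [set v] \in cliques.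
Proof.
rewrite inE -cards_eq0 cards1 /=.
apply/forall_inP => x /set1P->; apply/forall_inP => y /set1P->.
by rewrite eqxx.
Qed.

Definition clique_complex : scomplex :=
  SComplex cliques_neq0 cliques_sub cliques_vertex.

End CliqueComplex.

Section FaceGraph.
Variable K : scomplex.

Definition face_adj : rel {s : {set K} | s \in simplices K} :=
  fun s t => (s != t) && ((val s \subset val t) || (val t \subset val s)).

Lemma face_adj_sym : symmetric face_adj.
Proof. by move=> s t; rewrite /face_adj eq_sym orbC. Qed.

Lemma face_adj_irrefl : irreflexive face_adj.
Proof. by move=> s; rewrite /face_adj eqxx. Qed.

Definition face_graph : sgraph := SGraph face_adj_sym face_adj_irrefl.

End FaceGraph.

(* Main.v *)
(* A vertex whose link is dismantlable can be removed from a flag complex by  *)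
(* elementary collapses, so clique complexes turn s-deletions into collapses. *)
(* Conversely, if (sigma, tau) is a free pair, then in the face graph tau is  *)
(* dominated by sigma, and after its deletion the neighbourhood of sigma is   *)
(* dismantlable: a face s avoiding the vertex v of sigma outside tau is       *)
(* dominated by v |: s, and the faces containing v are dominated by [set v].  *)
(* It remains to relate G to the face graph of its clique complex, and K to   *)
(* the clique complex of its face graph.  Both are done by a cylinder on the  *)
(* disjoint union of the vertices and the simplices, in which v and s are     *)
(* adjacent when v |: s is a simplex: each simplex s is dominated by any of   *)
(* its vertices, and the link of a vertex v is dismantlable, as s avoiding v  *)
(* is dominated by v |: s and everything else by [set v].                     *)

Require Import Defs.
From mathcomp Require Import all_boot.
Set Implicit Arguments.
Unset Strict Implicit.
Unset Printing Implicit Defensive.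

(** Both constructions carry elementary moves to homotopies: passing to clique complexes turns an
    s-deletion into a series of collapses ([s_deletion_clique_complex]), and passing to face graphs
    turns an elementary collapse into two s-deletions ([elementary_collapse_face_graph]). These are
    the two forward implications. The converses become formal once the composites are known: a graph
    has the s-homotopy type of the face graph of its clique complex ([same_s_face_graph]), and a
    complex has the simple-homotopy type of the clique complex of its face graph, which is its
    barycentric subdivision ([same_simple_clique_complex]). From an equivalence of clique complexes
    one passes to face graphs and undoes the composite at both ends; the other converse is
    symmetric.

    All four facts rest on one device, [dism]: a finite set is emptied down to a point, each
    discarded element being dominated by one that remains. It is used for domination in graphs and
    for domination in the link of a vertex, and [fcollapse_link] converts a dismantling of the link
    into collapses. The recurring pattern is [dism_remove] followed by [dism_cone]: faces avoiding a
    vertex [v] give way to their union with [v], and then [[set v]] dominates everything left. *)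

Lemma setD1D1 (T : finType) (A U : {set T}) x :
  x \in U -> (A :\ x) :\: (U :\ x) = A :\: U.
Proof.
move=> Ux; apply/setP=> z; rewrite !inE; case: eqP => [->|_] //=.
by rewrite Ux.
Qed.

Lemma imset_setD (T T' : finType) (f : T -> T') (A B : {set T}) :
  injective f -> f @: (A :\: B) = f @: A :\: f @: B.
Proof.
move=> f_inj; apply/setP=> y; rewrite in_setD.
apply/imsetP/andP => [[z /setDP[Az Bz] ->]|[fBy /imsetP[z Az def_y]]].
  by rewrite !mem_imset.
by exists z; rewrite // inE Az andbT -(mem_imset _ _ f_inj) -def_y.
Qed.

Lemma imset_setD1 (T T' : finType) (f : T -> T') (A : {set T}) x :
  injective f -> f @: (A :\ x) = f @: A :\ f x.
Proof. by move=> f_inj; rewrite imset_setD // imset_set1. Qed.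

(** * Dismantlings for an abstract domination relation *)

Section Dismantling.
Variables (T : finType) (dom : {set T} -> T -> T -> Prop).

Inductive dism : {set T} -> Prop :=
| dism_set1 x : dism [set x]
| dism_setD1 (A : {set T}) x y :
    x \in A -> y \in A -> y != x -> dom A x y -> dism (A :\ x) -> dism A.

Hypothesis dom_anti : forall (A B : {set T}) x y,
  B \subset A -> dom A x y -> dom B x y.

(** The elements of [U] leave in order of decreasing [mu], so when [x] goes, only members of [U]
    with [mu] at most [mu x] are still present. The dominators [f x] lie outside [U] and remain
    available throughout. *)
Lemma dism_remove (f : T -> T) (mu : T -> nat) (A U : {set T}) :
    U \subset A ->
    (forall x, x \in U -> f x \in A :\: U) ->
    (forall x, x \in U ->
       dom [set z in A | (z \notin U) || (mu z <= mu x)] x (f x)) ->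
  dism (A :\: U) -> dism A.
Proof.
have [n leUn] := ubnP #|U|; elim: n A U leUn => // n IHn A U leUn sUA fU domU.
have [->|[x0 Ux0]] := set_0Vmem U; first by rewrite setD0.
case: (arg_maxnP mu Ux0) => x Px xmax dismAU.
have Ux : x \in U by exact: Px.
have /setDP[Afx Ufx] := fU x Ux.
have neq_fx : f x != x by apply: contraNneq Ufx => ->.
have eqAU := setD1D1 A Ux.
apply: (@dism_setD1 _ x (f x)) => //.
- by apply: (subsetP sUA).
- apply: dom_anti (domU x Ux); apply/subsetP => z Az; rewrite inE Az /=.
  by case: (boolP (z \in U)) => //= Uz; apply: xmax.
apply: (IHn _ (U :\ x)); last by rewrite eqAU.
- by move: leUn; rewrite (cardsD1 x) Ux.
- by apply: setSD.
- by move=> z /setD1P[_ Uz]; rewrite eqAU; apply: fU.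
move=> z /setD1P[_ Uz]; apply: dom_anti (domU z Uz).
apply/subsetP=> w; rewrite !inE => /andP[/andP[-> ->]] /=.
by case: (w \in U).
Qed.

Lemma dism_cone (A : {set T}) y :
  y \in A -> (forall x, x \in A -> x != y -> dom A x y) -> dism A.
Proof.
move=> Ay domA; have eqAD : A :\: (A :\ y) = [set y].
  apply/setP=> z; rewrite !inE; case: eqP => [->|] /=; last by case: (z \in A).
  by rewrite Ay.
apply: (@dism_remove (fun=> y) (fun=> 0) _ (A :\ y)).
- by apply: subsetDl.
- by move=> x _; rewrite eqAD set11.
- move=> x /setD1P[neq_x Ax]; apply: dom_anti (domA x Ax neq_x).
  by apply/subsetP=> z /setIdP[].
by rewrite eqAD; apply: dism_set1.
Qed.

End Dismantling.

(** * Domination and dismantlability in graphs *)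

Section GraphDismantling.
Variable G : sgraph.
Implicit Types (A B : {set G}) (x y : G).

Definition gdom A x y : Prop := closed_nbh x :&: A \subset closed_nbh y.

Lemma gdom_anti A B x y : B \subset A -> gdom A x y -> gdom B x y.
Proof. by move=> sBA; apply: subset_trans; apply: setIS. Qed.

Lemma mem_closed_nbh x z : (z \in closed_nbh x) = (z == x) || adj x z.
Proof. by rewrite !inE. Qed.

Lemma dominated_gdom A x y :
  dominated_in A x y <-> [/\ x \in A, y \in A, y != x & gdom A x y].
Proof.
rewrite /gdom /dominated_in; split.
  by case/and4P=> Ax Ay neq_yx; rewrite subsetI => /andP[].
by case=> -> -> -> /= sxy; rewrite subsetI sxy subsetIr.
Qed.

(** The list is read backwards: its last vertex is the first one that [dism_setD1] removes from the
    whole of [A]. *)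
Lemma dismantlableP A : dismantlable A <-> dism gdom A.
Proof.
split=> [[s []]|].
  elim/last_ind: s A => // s x IHs A eqA uniq_s _ dom_s.
  have eqAx : s =i A :\ x.
    move=> z; rewrite !inE -eqA mem_rcons inE; case: eqP => //= ->.
    by apply/negbTE; move: uniq_s; rewrite rcons_uniq => /andP[].
  have [s0|s_n0] := eqVneq s [::].
    rewrite (_ : A = [set x]); first exact: dism_set1.
    by apply/setP=> z; rewrite -eqA s0 !inE.
  have [y] := dom_s s [::] x (esym (cats1 _ _)) s_n0.
  rewrite (_ : [set z in rcons s x] = A); last by apply/setP=> z; rewrite inE.
  move/dominated_gdom=> [Ax Ay neq_yx dom_xy].
  apply: (dism_setD1 Ax Ay neq_yx dom_xy); apply: IHs => //.
    by move: uniq_s; rewrite rcons_uniq => /andP[].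
  by move=> p q g def_s; apply: (dom_s p (rcons q x)); rewrite def_s rcons_cat.
elim=> [x|{}A x y Ax Ay neq_yx dom_xy _ [s [eqA uniq_s s_n0 dom_s]]].
  exists [:: x]; split=> // [z|[|? []] q g]; rewrite ?inE //.
have eqAx : rcons s x =i A.
  by move=> z; rewrite mem_rcons inE eqA !inE; case: eqP => //= ->.
exists (rcons s x); split=> //.
- by rewrite rcons_uniq uniq_s eqA !inE eqxx.
- by case: (s).
move=> p q g; case/lastP: q => [|q z].
  rewrite cats1 => /rcons_inj[<- <-] _; exists y; apply/dominated_gdom.
  by rewrite (_ : [set _ in _] = A) //; apply/setP=> z; rewrite inE.
by rewrite -rcons_cons -rcons_cat => /rcons_inj[def_s _]; apply: dom_s def_s.
Qed.

End GraphDismantling.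

(** * Graphs as induced subgraphs of an ambient graph; s-homotopy as an equivalence *)

Section GraphEmbedding.

(** [f] identifies [G] with the subgraph of [M] induced by [A], so that moves between isomorphism
    types become operations on vertex subsets of one graph. *)
Definition graph_emb (G M : sgraph) (f : G -> M) (A : {set M}) : Prop :=
  [/\ injective f, forall x y, adj (f x) (f y) = adj x y & f @: setT = A].

Lemma graph_emb_comp (G M N : sgraph) (f : G -> M) (g : M -> N) A B :
  graph_emb f A -> graph_emb g B -> graph_emb (g \o f) (g @: A).
Proof.
case=> f_inj f_adj <- [g_inj g_adj _]; split; first exact: inj_comp.
  by move=> x y; rewrite /= g_adj f_adj.
by rewrite imset_comp.
Qed.

Lemma graph_emb_val (G : sgraph) (A : {set G}) :
  graph_emb (val : induced A -> G) A.
Proof.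
split=> //; first exact: val_inj.
apply/setP=> x; apply/imsetP/idP => [[u _ ->]|Ax]; first exact: valP.
by exists (Sub x Ax).
Qed.

Lemma emb_iso (G H M : sgraph) (f : G -> M) (h : H -> M) A :
  graph_emb f A -> graph_emb h A -> graph_iso G H.
Proof.
case=> f_inj f_adj def_A [h_inj h_adj def_A'].
have fh x : f x \in codom h.
  have : f x \in A by rewrite -def_A imset_f.
  by rewrite -def_A' => /imsetP[y _ ->]; apply: codom_f.
have hf y : h y \in codom f.
  have : h y \in A by rewrite -def_A' imset_f.
  by rewrite -def_A => /imsetP[x _ ->]; apply: codom_f.
exists (fun x => iinv (fh x)); last first.
  by move=> x y; rewrite -h_adj !f_iinv f_adj.
exists (fun y => iinv (hf y)) => [x|y].
  by apply: f_inj; rewrite !f_iinv.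
by apply: h_inj; rewrite !f_iinv.
Qed.

Lemma iso_emb (G H : sgraph) :
  graph_iso G H -> exists f : G -> H, graph_emb f setT.
Proof.
case=> f [g fK gK] f_adj; exists f; split=> //; first exact: can_inj fK.
by apply/setP=> y; rewrite inE; apply/imsetP; exists (g y).
Qed.

Lemma emb_id (G : sgraph) : graph_emb (id : G -> G) setT.
Proof. by split=> //; apply: imset_id. Qed.

Lemma graph_iso_sym (G H : sgraph) : graph_iso G H -> graph_iso H G.
Proof. by case/iso_emb=> f embf; apply: emb_iso (emb_id H) embf. Qed.

Lemma iso_emb_comp (G H M : sgraph) (f : H -> M) A :
  graph_iso G H -> graph_emb f A -> exists g : G -> M, graph_emb g A.
Proof.
case/iso_emb=> g embg embf; exists (f \o g).
by case: (embf) => _ _ <-; apply: graph_emb_comp embg embf.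
Qed.

Lemma graph_iso_trans (G H J : sgraph) :
  graph_iso G H -> graph_iso H J -> graph_iso G J.
Proof.
move=> isoGH /iso_emb[f embf]; have [g embg] := iso_emb_comp isoGH embf.
exact: emb_iso embg (emb_id J).
Qed.

Lemma emb_closed_nbh (G M : sgraph) (f : G -> M) A x z :
  graph_emb f A -> (f z \in closed_nbh (f x)) = (z \in closed_nbh x).
Proof.
by case=> f_inj f_adj _; rewrite !mem_closed_nbh f_adj (inj_eq f_inj).
Qed.

Lemma emb_gdom (G M : sgraph) (f : G -> M) A (B : {set G}) x y :
  graph_emb f A -> gdom (f @: B) (f x) (f y) <-> gdom B x y.
Proof.
move=> embf; split=> /subsetP sxy; apply/subsetP.
  move=> z /setIP[xz Bz]; rewrite -(emb_closed_nbh _ _ embf); apply: sxy.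
  by rewrite inE (emb_closed_nbh _ _ embf) xz imset_f.
move=> w /setIP[+ /imsetP[z Bz def_w]]; rewrite {w}def_w.
rewrite !(emb_closed_nbh _ _ embf) => xz; apply: sxy.
by rewrite inE xz.
Qed.

Lemma emb_dism (G M : sgraph) (f : G -> M) A (B : {set G}) :
  graph_emb f A -> dism (@gdom M) (f @: B) -> dism (@gdom G) B.
Proof.
move=> embf; have [f_inj _ _] := embf.
move def_C: (f @: B) => C dismC; elim: dismC B def_C => [x|{}C x y].
  move=> B def_x.
  have /imsetP[u Bu def_u] : x \in f @: B by rewrite def_x set11.
  suff -> : B = [set u] by apply: dism_set1.
  by apply: (imset_inj f_inj); rewrite def_x imset_set1 def_u.
move=> Cx Cy neq_yx dom_xy _ IHC B def_C; move: Cx Cy neq_yx dom_xy IHC.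
rewrite -def_C => /imsetP[u Bu ->] /imsetP[v Bv ->] neq_vu dom_uv IHC.
apply: (dism_setD1 Bu Bv).
- by apply: contraNneq neq_vu => ->.
- exact: (proj1 (emb_gdom B u v embf) dom_uv).
by apply: IHC; rewrite imset_setD1.
Qed.

Lemma emb_open_nbh (G M : sgraph) (f : G -> M) A x :
  graph_emb f A -> open_nbh (f x) :&: A = f @: open_nbh x.
Proof.
case=> f_inj f_adj <-; apply/setP=> y; rewrite !inE.
apply/andP/imsetP => [[+ /imsetP[z _ def_y]]|[z + ->]].
  by rewrite def_y f_adj => xz; exists z; rewrite ?inE.
by rewrite inE f_adj => ->; rewrite imset_f.
Qed.

Lemma emb_setD1 (G M : sgraph) (f : G -> M) A x :
  graph_emb f A -> f @: [set~ x] = A :\ f x.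
Proof.
case=> f_inj _ <-; rewrite -imset_setD1 //.
by rewrite setTD.
Qed.

Lemma s_deletionP (G H : sgraph) :
  s_deletion G H <->
    exists2 g : G, s_dismantlable g
      & exists h : H -> G, graph_emb h [set~ g].
Proof.
split=> [] [g s_g] => [isoH|[h embh]]; exists g => //.
  by apply: iso_emb_comp (graph_emb_val _); apply: graph_iso_sym.
exact: emb_iso (graph_emb_val _) embh.
Qed.

(** Brings a dismantling found inside [M] back to abstract graphs: the neighbourhood of the preimage
    of [x] in [G] maps onto [open_nbh x :&: A]. *)
Lemma s_deletion_emb (G H M : sgraph) (f : G -> M) (h : H -> M) A x :
    graph_emb f A -> graph_emb h (A :\ x) -> x \in A ->
  dism (@gdom M) (open_nbh x :&: A) -> s_deletion G H.
Proof.
move=> embf embh Ax; have [_ _ def_A] := embf.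
move: Ax embh; rewrite -{1}def_A => /imsetP[g _ ->] embh.
rewrite (emb_open_nbh _ embf) => /(emb_dism embf)/dismantlableP s_g.
exists g => //; apply: emb_iso embh.
by rewrite -(emb_setD1 _ embf); apply: graph_emb_comp (graph_emb_val _) embf.
Qed.

Lemma iso_s_deletion (G G' H : sgraph) :
  graph_iso G G' -> s_deletion G' H -> s_deletion G H.
Proof.
case/iso_emb=> f embf /s_deletionP[g s_g [h embh]].
apply: (s_deletion_emb (x := g) embf); rewrite ?inE ?setTD ?setIT //.
  exact: embh.
by apply/dismantlableP.
Qed.

Lemma s_deletion_iso (G H H' : sgraph) :
  s_deletion G H -> graph_iso H H' -> s_deletion G H'.
Proof.
by case=> g s_g isoH isoH'; exists g => //; apply: graph_iso_trans isoH'.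
Qed.

Lemma same_s_trans (G H J : sgraph) :
  same_s_homotopy_type G H -> same_s_homotopy_type H J ->
  same_s_homotopy_type G J.
Proof.
elim=> [{}G {}H isoGH sHJ|{}G I {}H stepGI _ IHI /IHI]; last first.
  exact: s_homotopy_step.
(* Isomorphisms occur only at the end of a chain, so the one that ends the first chain is absorbed
   into the first step of the second. *)
case: sHJ isoGH => [{}H {}J isoHJ|{}H I {}J stepHI sIJ] isoGH; last first.
  apply: s_homotopy_step sIJ; case: stepHI => [delH|delI]; [left|right].
    exact: iso_s_deletion delH.
  exact: s_deletion_iso delI (graph_iso_sym isoGH).
by apply: s_homotopy_iso; apply: graph_iso_trans isoHJ.
Qed.

Lemma same_s_sym (G H : sgraph) :
  same_s_homotopy_type G H -> same_s_homotopy_type H G.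
Proof.
elim=> [{}G {}H isoGH|{}G J {}H stepGJ _ IHJ].
  by apply: s_homotopy_iso; apply: graph_iso_sym.
apply: same_s_trans IHJ _; apply: s_homotopy_step (s_homotopy_iso _).
  by case: stepGJ => del; [right|left]; exact: del.
by apply: emb_iso; apply: emb_id.
Qed.

End GraphEmbedding.

(** * Successive s-deletions inside one graph *)

Section GraphCollapse.
Variable M : sgraph.
Implicit Types A B U : {set M}.

Inductive gcollapse : {set M} -> {set M} -> Prop :=
| gcollapse_refl A : gcollapse A A
| gcollapse_step A x B :
    x \in A -> dism (@gdom M) (open_nbh x :&: A) ->
    gcollapse (A :\ x) B -> gcollapse A B.

Lemma gcollapse_same A B : gcollapse A B ->
  forall (G H : sgraph) (f : G -> M) (h : H -> M),
    graph_emb f A -> graph_emb h B -> same_s_homotopy_type G H.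
Proof.
elim=> {A B} [A G H f h embf embh|A x B Ax dism_x _ IH G H f h embf embh].
  by apply: s_homotopy_iso; apply: emb_iso embf embh.
apply: s_homotopy_step (IH _ _ _ _ (graph_emb_val _) embh).
by left; apply: s_deletion_emb embf (graph_emb_val _) Ax dism_x.
Qed.

(** The neighbourhoods are required to be dismantlable in every intermediate [B], so the order of
    the deletions does not matter. *)
Lemma gcollapse_remove A U :
    U \subset A ->
    (forall B x, A :\: U \subset B -> B \subset A -> x \in U -> x \in B ->
       dism (@gdom M) (open_nbh x :&: B)) ->
  gcollapse A (A :\: U).
Proof.
have [n] := ubnP #|U|; elim: n A U => // n IHn A U leUn sUA dismU.
have [->|[x Ux]] := set_0Vmem U; first by rewrite setD0; apply: gcollapse_refl.
have Ax := subsetP sUA x Ux.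
have eqAU := setD1D1 A Ux.
apply: (gcollapse_step (x := x)) => //.
  by apply: dismU => //; apply: subsetDl.
rewrite -eqAU; apply: IHn; first by move: leUn; rewrite (cardsD1 x) Ux.
  exact: setSD.
move=> B y; rewrite eqAU => sAUB sBA /setD1P[_ Uy] By; apply: dismU => //.
by apply: subset_trans sBA _; apply: subsetDl.
Qed.

End GraphCollapse.

(** * Collapses of families of subsets of a fixed set *)

Section SetFamilies.
Variable T : finType.
Implicit Types (F : {set {set T}}) (s t : {set T}).

(** Unlike in [scomplex], points of [T] need not be vertices, so the carrier stays fixed while faces
    disappear. *)
Definition is_complex F : Prop :=
  set0 \notin F /\
  forall s t, s \in F -> t != set0 -> t \subset s -> t \in F.

Definition free_in F s t : Prop :=
  [/\ s \in F, t \in F, t \subset s, #|s| = #|t|.+1 &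
      forall r, r \in F -> t \proper r -> r = s].

Inductive fcollapse : {set {set T}} -> {set {set T}} -> Prop :=
| fcollapse_refl F : fcollapse F F
| fcollapse_step F s t F' :
    free_in F s t -> fcollapse (F :\: [set s; t]) F' -> fcollapse F F'.

Lemma fcollapse_trans F1 F2 F3 :
  fcollapse F1 F2 -> fcollapse F2 F3 -> fcollapse F1 F3.
Proof.
elim=> // F s t F' free_st _ IH cF23; exact: fcollapse_step free_st (IH cF23).
Qed.

Lemma is_complex_free F s t :
  is_complex F -> free_in F s t -> is_complex (F :\: [set s; t]).
Proof.
case=> F0 Fsub [Fs Ft sts card_s uniq_s]; split=> [|u v].
  by rewrite inE negb_and F0 orbT.
rewrite !inE !negb_or => /andP[/andP[neq_us neq_ut] Fu] v0 svu.
rewrite (Fsub _ _ Fu v0 svu) andbT; apply/andP; split.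
  apply: contraNneq neq_us => def_v; apply/eqP/uniq_s => //.
  rewrite properE; apply/andP; split.
    by apply: subset_trans svu; rewrite def_v.
  apply: contra_eqN card_s => sut; rewrite neq_ltn ltnS subset_leq_card //.
  by apply: subset_trans sut; rewrite -def_v.
apply: contraNneq neq_us => def_v; apply/eqP/uniq_s => //.
by rewrite properEneq -def_v svu andbT def_v eq_sym.
Qed.

(* Among the simplices of F outside F' that avoid y, one of maximal size is a *)
(* free face of its union with y.                                             *)
Lemma fcollapse_toggle F F' y :
    is_complex F -> is_complex F' -> F' \subset F ->
    (forall s, s \in F :\: F' ->
       y |: s \in F :\: F' /\ s :\ y \in F :\: F') ->
  fcollapse F F'.
Proof.
have [n] := ubnP #|F :\: F'|; elim: n F => // n IHn F leFn cF cF' sF'F tog.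
have [/eqP|[s0 Ds0]] := set_0Vmem (F :\: F').
  rewrite setD_eq0 => sFF'; rewrite (_ : F = F'); first exact: fcollapse_refl.
  by apply/eqP; rewrite eqEsubset sFF'.
have Pt0 : (s0 :\ y \in F :\: F') && (y \notin s0 :\ y).
  by rewrite (tog _ Ds0).2 setD11.
pose P t := (t \in F :\: F') && (y \notin t).
case: (@arg_maxnP _ _ P (fun t => #|t|) Pt0) => t /andP[Dt yt] tmax.
have [Dyt _] := tog t Dt.
have [[Ft F't] [Fyt F'yt]] := (setDP Dt, setDP Dyt).
have free_t : free_in F (y |: t) t.
  split=> //; first exact: subsetUr.
    by rewrite cardsU1 yt.
  move=> r Fr /properP[str [z rz tz]].
  have Dr : r \in F :\: F'.
    rewrite inE Fr andbT; apply: contra F't => F'r; apply: cF'.2 F'r _ str.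
    by apply: contraTneq Ft => ->; case: cF.
  have st : t \subset r :\ y by rewrite subsetD1 str.
  have /tmax/= le_t : P (r :\ y) by rewrite /P (tog r Dr).2 setD11.
  have /eqP def_t : t == r :\ y by rewrite eqEcard st.
  rewrite def_t setD1K //; apply: contraNT tz => yr; rewrite def_t.
  by rewrite in_setD1 rz andbT; apply: contraNneq yr => <-.
apply: (fcollapse_step free_t).
have eqD : (F :\: [set y |: t; t]) :\: F' = (F :\: F') :\: [set y |: t; t].
  by rewrite !setDDl setUC.
apply: IHn => //.
- rewrite -ltnS; apply: leq_trans leFn; rewrite ltnS eqD; apply: proper_card.
  apply/properP; split; first exact: subsetDl.
  by exists t; rewrite // !inE eqxx orbT.
- exact: is_complex_free cF free_t.
- rewrite subsetD sF'F /=; apply/pred0P=> s /=; apply/negbTE.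
  apply: contraNN F't => /andP[F's]; rewrite !inE => /orP[]/eqP def_s.
    by rewrite def_s (negPf F'yt) in F's.
  by rewrite -def_s.
(* Toggling [y] exchanges the two removed faces, hence preserves the rest of the difference. *)
rewrite eqD => s /setDP[Ds]; rewrite !inE negb_or => /andP[neq_yt neq_t].
have [/setDP[-> ->] /setDP[-> ->]] := tog s Ds; rewrite !andbT !negb_or.
have [ys|ys] := boolP (y \in s).
  have -> : y |: s = s by apply/setUidPr; rewrite sub1set.
  rewrite neq_yt neq_t /=; split=> //; apply/andP; split.
    by apply: contraTneq (setU11 y t) => <-; rewrite setD11.
  by apply: contraNneq neq_yt => <-; rewrite setD1K.
have -> : s :\ y = s by apply/setDidPl; rewrite disjoint_sym disjoints1.
rewrite neq_yt neq_t /=; split=> //; apply/andP; split.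
  apply: contraNneq neq_t => def_s; rewrite -(setU1K ys) def_s.
  by rewrite setU1K.
by apply: contraTneq (setU11 y s) => ->.
Qed.

End SetFamilies.

(** * Collapsing away a vertex whose link is dismantlable *)

Section LinkCollapse.
Variables (T : finType) (F : {set {set T}}) (v : T).
Hypothesis cF : is_complex F.

(** This is the domination of strong collapses: in the link of [v] restricted to [A], the link of
    [x] is a cone with apex [y]. *)
Definition link_dom (A : {set T}) (x y : T) : Prop :=
  forall s, s \in F -> v \in s -> x \in s -> s \subset v |: A -> y |: s \in F.

Lemma link_dom_anti (A B : {set T}) x y :
  B \subset A -> link_dom A x y -> link_dom B x y.
Proof.
move=> sBA dom_xy s Fs vs xs ssB; apply: dom_xy => //.
by apply: subset_trans ssB _; apply: setUS.
Qed.

Definition link_vertices : {set T} := [set z | (z != v) && ([set v; z] \in F)].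

Lemma is_complex_sep (P : pred {set T}) :
  (forall s t : {set T}, P s -> t \subset s -> P t) ->
  is_complex [set s in F | P s].
Proof.
move=> Psub; split=> [|s t]; first by rewrite inE negb_and cF.1.
rewrite !inE => /andP[Fs Ps] t0 sts.
by rewrite (cF.2 s t Fs t0 sts) (Psub s t Ps sts).
Qed.

(** Among the faces through [v], [FB B] keeps those inside [v |: B]. When [x], dominated by [y],
    leaves [A], the faces lost are those within [v |: A] that contain [v] and [x], and they are
    closed under toggling [y]. When a single point [x] is left, the faces [[set v]] and [[set v; x]]
    are paired by toggling [x]. *)
Lemma fcollapse_link :
  dism link_dom link_vertices -> fcollapse F [set s in F | v \notin s].
Proof.
pose FB (B : {set T}) := [set s in F | (v \notin s) || (s \subset v |: B)].
have cFv : is_complex [set s in F | v \notin s].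
  by apply: is_complex_sep => s t vs /subsetP sts; apply: contra vs; apply: sts.
have cFB B : is_complex (FB B).
  apply: is_complex_sep => s t /orP[vs|ssB] sts; apply/orP; [left|right].
    by apply: contra vs; apply: (subsetP sts).
  exact: subset_trans ssB.
have -> : F = FB link_vertices.
  apply/setP=> s; rewrite inE; case Fs: (s \in F) => //=; apply/esym.
  case: (boolP (v \in s)) => //= vs; apply/subsetP=> z sz; rewrite !inE.
  case: eqP => //= _; apply: cF.2 Fs _ _.
    by apply/set0Pn; exists v; rewrite set21.
  by apply/subsetP=> w /set2P[]->.
have -> : [set s in FB link_vertices | v \notin s] = [set s in F | v \notin s].
  by apply/setP=> s; rewrite !inE; case: (v \in s); rewrite ?andbF ?orbT ?andbT.
move=> dismL; have := subxx link_vertices.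
(* The second occurrence is not generalised, so the induction remembers that the current set lies in
   [link_vertices]. *)
elim: {-2}_ / dismL => [x|A x y Ax Ay neq_yx dom_xy _ IHA] sA.
  have : x \in link_vertices by rewrite (subsetP sA) ?set11.
  rewrite inE => /andP[neq_xv Fvx].
  apply: (@fcollapse_toggle _ _ _ x) => // [|s].
    by apply/subsetP=> s; rewrite !inE => /andP[-> ->].
  rewrite !inE => /andP[+ /andP[Fs]]; rewrite Fs negbK /= => vs.
  have neq_vx : v != x by rewrite eq_sym.
  rewrite !vs neq_vx !orbT !andbF /= => ssvx.
  have vsx : v \in s :\ x by rewrite in_setD1 neq_vx.
  split; apply/andP; split.
  - apply: cF.2 Fvx _ _; first by apply/set0Pn; exists x; apply: setU11.
    by rewrite subUset sub1set set22.
  - by rewrite subUset sub1set set22.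
  - by apply: cF.2 Fs _ _; [apply/set0Pn; exists v | apply: subD1set].
  - by apply: subset_trans ssvx; apply: subD1set.
have /setIdP[/= neq_yv _] : y \in link_vertices by apply: (subsetP sA).
have /setIdP[/= neq_xv _] : x \in link_vertices by apply: (subsetP sA).
apply: (fcollapse_trans (F2 := FB (A :\ x))); last first.
  by apply: IHA; apply: subset_trans sA; apply: subD1set.
apply: (@fcollapse_toggle _ _ _ y) => // [|s].
  apply/subsetP=> s; rewrite !inE => /andP[-> /orP[->|ss]] //=.
  by rewrite (subset_trans ss) ?orbT // setUS // subD1set.
case/setDP=> /setIdP[Fs]; rewrite inE Fs negb_or negbK /= => /orP[|ssA].
  by move=> /negbTE->.
case/andP=> vs nss.
(* Otherwise [s] would already lie in [v |: (A :\ x)]. *)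
have xs : x \in s.
  apply: contraNT nss => xs; apply/subsetP=> z sz; rewrite !inE.
  have := subsetP ssA z sz; rewrite !inE => /orP[->//|->].
  by rewrite (contraNneq _ xs) ?orbT // => <-.
have memD (t : {set T}) : t \in F -> v \in t -> x \in t -> t \subset v |: A ->
    t \in FB A :\: FB (A :\ x).
  move=> Ft vt xt stA; apply/setDP; split; rewrite inE Ft vt ?stA //=.
  by apply/subsetPn; exists x; rewrite // !inE negb_or neq_xv eqxx.
have vsy : v \in s :\ y by rewrite in_setD1 vs eq_sym neq_yv.
have xsy : x \in s :\ y by rewrite in_setD1 xs eq_sym neq_yx.
split; apply: memD; rewrite ?setU1r //; first exact: dom_xy.
- by rewrite subUset sub1set ssA !inE Ay orbT.
- by apply: cF.2 Fs _ (subD1set _ _); apply/set0Pn; exists v.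
- by apply: subset_trans ssA; apply: subD1set.
Qed.

End LinkCollapse.

(** * Complexes as families on an ambient set *)

Section ComplexEmbedding.

Definition complex_emb (K : scomplex) (T : finType) (f : K -> T)
    (F : {set {set T}}) : Prop :=
  injective f /\ [set f @: s | s : {set K} in simplices K] = F.

Lemma complex_emb_comp (K L : scomplex) (T : finType)
    (f : K -> L) (g : L -> T) (E : {set {set L}}) F :
  complex_emb f E -> complex_emb g F ->
  complex_emb (g \o f) [set g @: s | s : {set L} in E].
Proof.
case=> f_inj <- [g_inj _]; split; first exact: inj_comp.
by rewrite -imset_comp; apply: eq_imset => s; apply: imset_comp.
Qed.

Lemma complex_emb_id (K : scomplex) :
  complex_emb (id : K -> K) (simplices K).
Proof.
split=> //; rewrite -[RHS]imset_id; apply: eq_imset => s; exact: imset_id.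
Qed.

Lemma mem_complex_emb (K : scomplex) (T : finType) (f : K -> T) F
    (s : {set K}) :
  complex_emb f F -> (f @: s \in F) = (s \in simplices K).
Proof.
by case=> f_inj <-; apply: mem_imset; apply: imset_inj.
Qed.

Lemma complex_emb_complex (K : scomplex) (T : finType) (f : K -> T) F :
  complex_emb f F -> is_complex F.
Proof.
move=> embf; have [f_inj def_F] := embf; split.
  by rewrite -(imset0 f) (mem_complex_emb _ embf) simplex_neq0.
move=> s t; rewrite -{1}def_F => /imsetP[u Ku def_s] t0 sts.
have def_t : f @: (f @^-1: t) = t.
  apply/setP=> y; apply/imsetP/idP => [[x + ->]|ty]; first by rewrite inE.
  have := subsetP sts y ty; rewrite def_s => /imsetP[x _ def_y].
  by exists x; rewrite // inE -def_y.
rewrite -def_t (mem_complex_emb _ embf); apply: (simplex_sub Ku).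
  by apply: contraNneq t0 => t'0; rewrite -def_t t'0 imset0.
by apply/subsetP=> x; rewrite inE => /(subsetP sts); rewrite def_s mem_imset.
Qed.

Lemma complex_emb_iso (K L : scomplex) (T : finType)
    (f : K -> T) (h : L -> T) F :
  complex_emb f F -> complex_emb h F -> complex_iso K L.
Proof.
move=> embf embh; have [[f_inj def_F] [h_inj def_F']] := (embf, embh).
have fh x : f x \in codom h.
  have : [set f x] \in F.
    by rewrite -imset_set1 (mem_complex_emb _ embf) simplex_vertex.
  rewrite -def_F' => /imsetP[s _ def_fx].
  have : f x \in h @: s by rewrite -def_fx set11.
  by case/imsetP=> y _ ->; apply: codom_f.
have hf y : h y \in codom f.
  have : [set h y] \in F.
    by rewrite -imset_set1 (mem_complex_emb _ embh) simplex_vertex.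
  rewrite -def_F => /imsetP[s _ def_hy].
  have : h y \in f @: s by rewrite -def_hy set11.
  by case/imsetP=> x _ ->; apply: codom_f.
exists (fun x => iinv (fh x)); last first.
  move=> s; rewrite -(mem_complex_emb _ embh) -imset_comp.
  rewrite -(mem_complex_emb s embf); congr (_ \in F).
  by apply: eq_imset => x /=; rewrite f_iinv.
exists (fun y => iinv (hf y)) => [x|y].
  by apply: f_inj; rewrite !f_iinv.
by apply: h_inj; rewrite !f_iinv.
Qed.

Lemma iso_complex_emb (K L : scomplex) :
  complex_iso K L -> exists f : K -> L, complex_emb f (simplices L).
Proof.
case=> f [g fK gK] f_simp; exists f; split; first exact: can_inj fK.
apply/setP=> s; apply/imsetP/idP => [[t Kt ->]|Ls]; first by rewrite f_simp.
have def_s : s = f @: (g @: s).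
  by rewrite -imset_comp -[LHS]imset_id; apply: eq_imset => x /=; rewrite gK.
by exists (g @: s); rewrite // -f_simp -def_s.
Qed.

Lemma complex_iso_sym (K L : scomplex) : complex_iso K L -> complex_iso L K.
Proof.
case/iso_complex_emb=> f embf.
exact: complex_emb_iso (complex_emb_id L) embf.
Qed.

Lemma iso_complex_emb_comp (K L : scomplex) (T : finType) (f : L -> T) F :
  complex_iso K L -> complex_emb f F -> exists g : K -> T, complex_emb g F.
Proof.
case/iso_complex_emb=> g embg embf; exists (f \o g).
by case: (embf) => _ <-; apply: complex_emb_comp embg embf.
Qed.

Lemma complex_iso_trans (K L M : scomplex) :
  complex_iso K L -> complex_iso L M -> complex_iso K M.
Proof.
move=> isoKL /iso_complex_emb[f embf].
have [g embg] := iso_complex_emb_comp isoKL embf.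
exact: complex_emb_iso embg (complex_emb_id M).
Qed.

(** The carrier is cut down to the points whose singleton lies in [F], because every element of the
    carrier of an [scomplex] is a vertex. *)
Lemma complex_emb_exists (T : finType) (F : {set {set T}}) :
  is_complex F -> exists (K : scomplex) (f : K -> T), complex_emb f F.
Proof.
case=> F0 Fsub; pose V := {x : T | [set x] \in F}.
pose S := [set s : {set V} | val @: s \in F].
have S0 : set0 \notin S by rewrite inE imset0.
have Ssub (s t : {set V}) : s \in S -> t != set0 -> t \subset s -> t \in S.
  rewrite !inE => Fs t0 sts; apply: Fsub Fs _ (imsetS _ sts).
  by rewrite imset_eq0.
have Svertex v : [set v] \in S by rewrite inE imset_set1 (valP v).
exists (SComplex S0 Ssub Svertex), val; split; first exact: val_inj.
apply/setP=> s; apply/imsetP/idP => [[t + ->]|Fs]; first by rewrite inE.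
have def_s : s = val @: (val @^-1: s : {set V}).
  apply/setP=> x; apply/idP/imsetP => [sx|[y + ->]]; last by rewrite inE.
  have Fx : [set x] \in F.
    apply: Fsub Fs _ _; last by rewrite sub1set.
    by apply/set0Pn; exists x; apply: set11.
  by exists (Sub x Fx); rewrite // inE.
by exists (val @^-1: s); rewrite // inE -def_s.
Qed.

Lemma elementary_collapseP (K L : scomplex) :
  elementary_collapse K L <->
  exists s t : {set K}, free_in (simplices K) s t /\
    exists h : L -> K, complex_emb h (simplices K :\: [set s; t]).
Proof.
split=> [[s [t [free_st [h h_inj def_L]]]]|[s [t [free_st [h [h_inj def_L]]]]]].
  by exists s, t; split=> //; exists h.
by exists s, t; split=> //; exists h.
Qed.

Lemma collapse_emb (K L : scomplex) (T : finType)
    (f : K -> T) (h : L -> T) F s t :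
    complex_emb f F -> complex_emb h (F :\: [set s; t]) -> free_in F s t ->
  elementary_collapse K L.
Proof.
move=> embf embh [Fs Ft sts card_s uniq_s].
have [[f_inj def_F] [h_inj def_E]] := (embf, embh).
move: Fs Ft; rewrite -{1 2}def_F => /imsetP[s' Ks' def_s] /imsetP[t' Kt' def_t].
have hf y : h y \in codom f.
  have : [set h y] \in F :\: [set s; t].
    by rewrite -imset_set1 (mem_complex_emb _ embh) simplex_vertex.
  rewrite -def_F => /setDP[/imsetP[u _ def_hy] _].
  have : h y \in f @: u by rewrite -def_hy set11.
  by case/imsetP=> x _ ->; apply: codom_f.
have finj : injective (fun u : {set K} => f @: u) by apply: imset_inj.
exists s', t'; split.
  split=> //.
  - move: sts; rewrite def_s def_t => /subsetP sts; apply/subsetP=> x t'x.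
    by have := sts _ (imset_f f t'x); rewrite mem_imset.
  - by move: card_s; rewrite def_s def_t !card_imset.
  move=> r Kr t'r; apply: finj; rewrite -def_s; apply: uniq_s.
    by rewrite (mem_complex_emb _ embf).
  have [sub_t [x rx t'x]] := properP t'r; apply/properP.
  rewrite def_t; split; first exact: imsetS.
  by exists (f x); rewrite mem_imset.
exists (fun y => iinv (hf y)).
  by move=> y z eq_yz; apply: h_inj; rewrite -(f_iinv (hf y)) eq_yz f_iinv.
have fh (u : {set L}) : f @: [set iinv (hf y) | y in u] = h @: u.
  by rewrite -imset_comp; apply: eq_imset => y /=; rewrite f_iinv.
apply/setP=> r; rewrite -(mem_imset _ _ finj) -[RHS](mem_imset _ _ finj).
rewrite -imset_comp (eq_imset _ (fun u => fh u)) def_E.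
by rewrite imset_setD // def_F imsetU1 imset_set1 -def_s -def_t.
Qed.

End ComplexEmbedding.

(** * Simple homotopy as an equivalence, and its link with collapses of families *)

Section SimpleHomotopy.

Lemma iso_elementary_collapse (K K' L : scomplex) :
  complex_iso K K' -> elementary_collapse K' L -> elementary_collapse K L.
Proof.
case/iso_complex_emb=> f embf /elementary_collapseP[s [t [free_st [h embh]]]].
exact: collapse_emb embf embh free_st.
Qed.

Lemma elementary_collapse_iso (K L L' : scomplex) :
  elementary_collapse K L -> complex_iso L' L -> elementary_collapse K L'.
Proof.
case/elementary_collapseP=> s [t [free_st [h embh]]] isoL.
apply/elementary_collapseP; exists s, t; split=> //.
exact: iso_complex_emb_comp isoL embh.
Qed.

Lemma same_simple_trans (K L M : scomplex) :
  same_simple_homotopy_type K L -> same_simple_homotopy_type L M ->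
  same_simple_homotopy_type K M.
Proof.
elim=> [{}K {}L isoKL sLM|{}K I {}L stepKI _ IHI /IHI]; last first.
  exact: simple_homotopy_step.
case: sLM isoKL => [{}L {}M isoLM|{}L I {}M stepLI sIM] isoKL; last first.
  apply: simple_homotopy_step sIM; case: stepLI => [colL|colI]; [left|right].
    exact: iso_elementary_collapse colL.
  exact: elementary_collapse_iso colI isoKL.
by apply: simple_homotopy_iso; apply: complex_iso_trans isoLM.
Qed.

Lemma same_simple_sym (K L : scomplex) :
  same_simple_homotopy_type K L -> same_simple_homotopy_type L K.
Proof.
elim=> [{}K {}L isoKL|{}K M {}L stepKM _ IHM].
  by apply: simple_homotopy_iso; apply: complex_iso_sym.
apply: same_simple_trans IHM _.
apply: simple_homotopy_step (simple_homotopy_iso _).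
  by case: stepKM => col; [right|left]; exact: col.
by apply: complex_emb_iso; apply: complex_emb_id.
Qed.

Lemma fcollapse_same (T : finType) (F F' : {set {set T}}) : fcollapse F F' ->
  forall (K L : scomplex) (f : K -> T) (h : L -> T),
    complex_emb f F -> complex_emb h F' -> same_simple_homotopy_type K L.
Proof.
elim=> {F F'} [F K L f h embf embh|F s t F' free_st _ IH K L f h embf embh].
  by apply: simple_homotopy_iso; apply: complex_emb_iso embf embh.
have cF := complex_emb_complex embf.
have [M [g embg]] := complex_emb_exists (is_complex_free cF free_st).
apply: simple_homotopy_step (IH _ _ _ _ embg embh).
by left; apply: collapse_emb embf embg free_st.
Qed.

End SimpleHomotopy.

(** * From s-deletions to collapses of clique complexes *)

Section CliqueCollapse.
Implicit Types G H M : sgraph.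

Lemma complete_setP G (A : {set G}) :
  reflect (forall x y, x \in A -> y \in A -> (x == y) || adj x y)
          (complete_set A).
Proof.
apply: (iffP forall_inP) => [compA x y Ax Ay|compA x Ax].
  by have /forall_inP/(_ y Ay) := compA x Ax; case: eqP.
apply/forall_inP=> y Ay; apply/implyP=> /negbTE neq_xy.
by have := compA x y Ax Ay; rewrite neq_xy.
Qed.

Lemma complete_setU1 G (A : {set G}) v :
  complete_set (v |: A) = complete_set A && (A \subset closed_nbh v).
Proof.
apply/complete_setP/andP => [compA|[/complete_setP compA /subsetP sAv] x y].
  split; first by apply/complete_setP=> x y Ax Ay; apply: compA; apply: setU1r.
  apply/subsetP=> x Ax; rewrite mem_closed_nbh eq_sym.
  by apply: compA; [apply: setU11 | apply: setU1r].
case/setU1P=> [->|Ax] /setU1P[->|Ay]; rewrite ?eqxx //.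
- by have := sAv y Ay; rewrite mem_closed_nbh eq_sym.
- by have := sAv x Ax; rewrite mem_closed_nbh adj_sym.
exact: compA.
Qed.

Lemma complete_subset G (A B : {set G}) :
  A \subset B -> complete_set B -> complete_set A.
Proof.
move=> /subsetP sAB /complete_setP compB; apply/complete_setP=> x y Ax Ay.
by apply: compB; apply: sAB.
Qed.

Lemma clique_complex_emb G H (h : H -> G) (A : {set G}) :
  graph_emb h A ->
  complex_emb (h : clique_complex H -> G) [set s in cliques G | s \subset A].
Proof.
case=> h_inj h_adj def_A; split=> //.
have h_complete (s : {set H}) : complete_set (h @: s) = complete_set s.
  apply/complete_setP/complete_setP => comp_s x y.
    move=> sx sy; rewrite -(inj_eq h_inj) -h_adj.
    by apply: comp_s; apply: imset_f.
  case/imsetP=> u su -> /imsetP[w sw ->]; rewrite (inj_eq h_inj) h_adj.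
  exact: comp_s.
apply/setP=> s; apply/imsetP/idP => [[t + ->]|].
  by rewrite !inE imset_eq0 h_complete -def_A imsetS ?subsetT // andbT.
rewrite !inE => /andP[/andP[s0 comp_s] sA].
have def_s : s = h @: (h @^-1: s).
  apply/setP=> x; apply/idP/imsetP => [sx|[y + ->]]; last by rewrite inE.
  have := subsetP sA x sx; rewrite -def_A => /imsetP[y _ def_x].
  by exists y; rewrite // inE -def_x.
exists (h @^-1: s) => //; rewrite inE -h_complete -def_s comp_s andbT.
by apply: contraNneq s0 => s'0; rewrite def_s s'0 imset0.
Qed.

(** The link of [g] has the neighbours of [g] as vertices. As a clique complex is determined by its
    edges, domination of [x] by [y] among these neighbours gives [link_dom]: a clique through [g]
    and [x] lies in the closed neighbourhood of [x], hence in that of [y]. *)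
Lemma s_deletion_clique_complex G H :
  s_deletion G H ->
  same_simple_homotopy_type (clique_complex G) (clique_complex H).
Proof.
case/s_deletionP=> g /dismantlableP s_g [h /clique_complex_emb embh].
have embG := complex_emb_id (clique_complex G).
have cG := complex_emb_complex embG.
apply: fcollapse_same embG embh => /=.
have -> : [set s in cliques G | s \subset [set~ g]] =
          [set s in cliques G | g \notin s].
  by apply/setP=> s; rewrite !inE subsetC sub1set inE.
apply: fcollapse_link => //.
have -> : link_vertices (cliques G) g = open_nbh g.
  apply/setP=> z; rewrite !inE complete_setU1 sub1set mem_closed_nbh.
  have := cliques_vertex z; rewrite inE => /andP[_ ->].
  rewrite -cards_eq0 cards2; case: eqP => [->|_] //=.
  by rewrite adj_irrefl.
have := subxx (open_nbh g).
elim: {-2}_ / s_g => [x _|A x y Ax Ay neq_yx /subsetP dom_xy _ IHA sA].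
  exact: dism_set1.
apply: (dism_setD1 Ax Ay neq_yx) => [s|]; last first.
  by apply: IHA; apply: subset_trans sA; apply: subD1set.
rewrite !inE complete_setU1 => /andP[s0 comp_s] gs xs /subsetP ssA.
rewrite comp_s andbC /=; apply/andP; split; last first.
  by apply/set0Pn; exists y; apply: setU11.
apply/subsetP=> z sz; have := ssA z sz.
case/setU1P=> [->|Az]; last first.
  apply: dom_xy; rewrite inE Az andbT mem_closed_nbh eq_sym.
  by have /complete_setP := comp_s; apply.
(* The case of the vertex [g], which lies outside [A]: it is adjacent to [y] because [A] stays
   inside [open_nbh g]. *)
have := subsetP sA y Ay; rewrite mem_closed_nbh inE adj_sym => ->.
exact: orbT.
Qed.

End CliqueCollapse.

(** * From elementary collapses to s-deletions of face graphs *)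

Section InclusionGraph.
Variable T : finType.
Implicit Types (s t : {set T}) (F : {set {set T}}).

(** Taken on all subsets of [T], the empty one included, so that the face graph of any complex
    embedded in [T] is an induced subgraph of a single graph. *)
Definition incl_adj : rel {set T} :=
  fun s t => (s != t) && ((s \subset t) || (t \subset s)).

Lemma incl_adj_sym : symmetric incl_adj.
Proof. by move=> s t; rewrite /incl_adj eq_sym orbC. Qed.

Lemma incl_adj_irrefl : irreflexive incl_adj.
Proof. by move=> s; rewrite /incl_adj eqxx. Qed.

Definition incl_graph : sgraph := SGraph incl_adj_sym incl_adj_irrefl.

Lemma incl_closed_nbh (s t : incl_graph) :
  (t \in closed_nbh s) = (s \subset t) || (t \subset s).
Proof.
rewrite mem_closed_nbh /adj /= /incl_adj eq_sym.
by case: eqP => //= ->; rewrite subxx.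
Qed.

(** The only delicate case is [s \subset t] with [v] outside [t], and there the cardinalities force
    [s = t]. The second hypothesis is what [dism_remove] provides when [mu] is the cardinality. *)
Lemma comparable_setU1 v s t :
    (s \subset t) || (t \subset s) -> (v \in t) || (#|t| <= #|s|) ->
  (v |: s \subset t) || (t \subset v |: s).
Proof.
case: (boolP (t \subset s)) => [sts _ _|_ /=].
  by apply/orP; right; apply: subset_trans sts _; apply: subsetUr.
rewrite orbF => sst /orP[vt|le_ts].
  by rewrite subUset sub1set vt sst.
have -> : s = t by apply/eqP; rewrite eqEcard sst.
by rewrite subsetUr orbT.
Qed.

Lemma face_graph_emb (K : scomplex) (f : K -> T) F :
  complex_emb f F ->
  graph_emb ((fun u => f @: val u) : face_graph K -> incl_graph) F.
Proof.
move=> embf; have [f_inj def_F] := embf.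
have finj : injective (fun u : {set K} => f @: u) by apply: imset_inj.
have f_sub (s t : {set K}) : (f @: s \subset f @: t) = (s \subset t).
  apply/idP/idP => [/subsetP sst|]; last exact: imsetS.
  by apply/subsetP=> x /(imset_f f)/sst; rewrite mem_imset.
split.
- by move=> u w /finj/val_inj.
- by move=> u w; rewrite /adj /= /incl_adj /face_adj !f_sub (inj_eq finj).
apply/setP=> s; apply/imsetP/idP => [[u _ ->]|].
  by rewrite (mem_complex_emb _ embf) (valP u).
by rewrite -def_F => /imsetP[t Kt ->]; exists (Sub t Kt).
Qed.

End InclusionGraph.

Lemma elementary_collapse_face_graph (K L : scomplex) :
  elementary_collapse K L ->
  same_s_homotopy_type (face_graph K) (face_graph L).
Proof.
case/elementary_collapseP=> s [t [free_st [h /face_graph_emb embL]]].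
have embK := face_graph_emb (complex_emb_id K).
have [Ks Kt sts card_s uniq_s] := free_st.
have neq_st : s != t.
  by apply: contra_eqN card_s => /eqP->; rewrite neq_ltn ltnS leqnn.
apply: gcollapse_same embK embL.
have -> : simplices K :\: [set s; t] = (simplices K :\ t) :\ s.
  by rewrite setDDl setUC.
have mem_nbh (x z : incl_graph K) : (z \in open_nbh x) =
    (z != x) && ((x \subset z) || (z \subset x)).
  by rewrite inE eq_sym.
(* Every neighbour of [t] is a face of [s], since [s] is the only simplex properly above [t]; so [s]
   is a cone point of the neighbourhood. *)
apply: (@gcollapse_step (incl_graph K) _ t) => //.
  set A := _ :&: _; have subA z : z \in A -> z \subset s.
    case/setIP; rewrite mem_nbh => /andP[neq_zt /orP[tz|zt]] Kz.
      by rewrite (uniq_s z Kz) // properEneq eq_sym neq_zt.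
    exact: subset_trans sts.
  apply: (@dism_cone _ _ (@gdom_anti (incl_graph K)) _ s) => [|z Az neq_zs].
    by apply/setIP; rewrite mem_nbh neq_st sts.
  apply/subsetP=> w /setIP[_ /subA ws].
  by rewrite incl_closed_nbh ws orbT.
apply: (@gcollapse_step (incl_graph K) _ s); last exact: gcollapse_refl.
  by rewrite in_setD1 neq_st.
have : 0 < #|s :\: t| by rewrite cardsD (setIidPr sts) card_s subSnn.
case/card_gt0P=> v /setDP[sv tv].
have def_s : s = v |: t.
  apply/esym/eqP; rewrite eqEcard subUset sub1set sv sts /=.
  by rewrite cardsU1 tv card_s.
set A := _ :&: _.
have memA (z : incl_graph K) :
    (z \in A) = [&& z \in simplices K, z \subset s, z != s & z != t].
  rewrite in_setI mem_nbh in_setD1; apply/idP/idP.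
    case/andP=> /andP[neq_zs cmp_zs] /andP[neq_zt Kz].
    rewrite neq_zs neq_zt Kz /= andbT; case/orP: cmp_zs => // sz.
    rewrite (uniq_s z Kz) // properEneq eq_sym neq_zt.
    exact: subset_trans sz.
  by case/and4P=> -> -> -> ->; rewrite orbT.
clearbody A.
pose f (z : incl_graph K) : incl_graph K := v |: z.
pose mu (z : incl_graph K) := #|z : {set K}|.
pose U : {set incl_graph K} := [set z : {set K} in A | v \notin z].
have memAU (z : incl_graph K) : (z \in A :\: U) = (z \in A) && (v \in z).
  by rewrite in_setD [_ \in U]inE negb_and negbK andbC; case: (z \in A).
(* The face [v |: z] is still available: it is not [s] because [z] is not [t], and it is not [t]
   because [v] is outside [t]. *)
apply: (@dism_remove _ _ (@gdom_anti (incl_graph K)) f mu _ U).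
- by apply/subsetP=> z /setIdP[].
- move=> z /setIdP[+ vz]; rewrite memAU !memA setU11 andbT.
  case/and4P=> Kz zs neq_zs neq_zt.
  have fzs : f z \subset s by rewrite /f subUset sub1set sv.
  have fz0 : f z != set0 by apply/set0Pn; exists v; apply: setU11.
  rewrite (simplex_sub Ks fz0 fzs) fzs /=; apply/andP; split.
    apply: contraNneq neq_zt; rewrite /f def_s => def_fz.
    by rewrite -(setU1K vz) def_fz setU1K.
  by apply: contraNneq tv => <-; apply: setU11.
- move=> z /setIdP[Az vz]; apply/subsetP=> w; rewrite inE !incl_closed_nbh.
  case/andP=> cmp_zw /setIdP[Aw]; rewrite inE Aw /= negbK.
  exact: comparable_setU1.
have sub1 (z : {set K}) : ([set v] \subset z) = (v \in z) by rewrite sub1set.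
(* The vertex [[set v]] has not been removed: [t] is nonempty, so [s] has at least two elements. *)
apply: (@dism_cone _ _ (@gdom_anti (incl_graph K)) _ [set v]).
  rewrite memAU memA simplex_vertex sub1 sv set11 andbT /=; apply/andP; split.
    apply: contra_eqN card_s => /eqP <-; rewrite cards1 eq_sym eqSS cards_eq0.
    by apply: contraTneq Kt => ->; rewrite simplex_neq0.
  by apply: contraNneq tv => <-; rewrite set11.
move=> z _ _; apply/subsetP=> w /setIP[_]; rewrite memAU => /andP[_ vw].
by rewrite incl_closed_nbh sub1 vw.
Qed.

Definition sum_set (V W : finType) (X : {set V}) (S : {set W}) : {set V + W} :=
  [set a | match a with inl v => v \in X | inr s => s \in S end].

(** * The cylinder between a graph and the face graph of its clique complex *)

Section GraphSubdivision.
Variable G : sgraph.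

(* Deleting the cliques from this graph leaves G, deleting the vertices of G  *)
(* leaves the face graph of its clique complex.                               *)
Definition cyl_adj : rel (G + {set G}) := fun a b =>
  match a, b with
  | inl v, inl w => adj v w
  | inl v, inr s | inr s, inl v => complete_set (v |: s)
  | inr s, inr t => incl_adj s t
  end.

Lemma cyl_adj_sym : symmetric cyl_adj.
Proof. by case=> [v|s] [w|t] //=; [apply: adj_sym | apply: incl_adj_sym]. Qed.

Lemma cyl_adj_irrefl : irreflexive cyl_adj.
Proof. by case=> [v|s]; [apply: adj_irrefl | apply: incl_adj_irrefl]. Qed.

Definition cyl_graph : sgraph := SGraph cyl_adj_sym cyl_adj_irrefl.

Local Notation cyl_set X S := (sum_set X S : {set cyl_graph}).

Lemma cyl_nbh_ll (v w : G) :
  ((inl w : cyl_graph) \in closed_nbh (inl v : cyl_graph)) =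
  complete_set [set v; w].
Proof.
rewrite mem_closed_nbh complete_setU1 sub1set mem_closed_nbh.
have := cliques_vertex w; rewrite inE => /andP[_ ->] /=.
by rewrite -[inl w == inl v]/(w == v).
Qed.

Lemma cyl_nbh_lr (v : G) (s : {set G}) :
  ((inr s : cyl_graph) \in closed_nbh (inl v : cyl_graph)) =
  complete_set (v |: s).
Proof. by rewrite mem_closed_nbh. Qed.

Lemma cyl_nbh_rl (v : G) (s : {set G}) :
  ((inl v : cyl_graph) \in closed_nbh (inr s : cyl_graph)) =
  complete_set (v |: s).
Proof. by rewrite mem_closed_nbh. Qed.

Lemma cyl_nbh_rr (s t : {set G}) :
  ((inr t : cyl_graph) \in closed_nbh (inr s : cyl_graph)) =
  (s \subset t) || (t \subset s).
Proof.
by rewrite -incl_closed_nbh !mem_closed_nbh -[inr t == inr s]/(t == s).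
Qed.

Lemma cyl_emb_l : graph_emb (inl : G -> cyl_graph) (cyl_set setT set0).
Proof.
split=> // [v w []//|]; apply/setP=> -[v|s]; rewrite !inE.
  by rewrite imset_f.
by apply/imsetP=> -[].
Qed.

Lemma cyl_emb_r :
  graph_emb
    ((fun u => inr (val u)) : face_graph (clique_complex G) -> cyl_graph)
    (cyl_set set0 (cliques G)).
Proof.
split=> // [u w [/val_inj]//|]; apply/setP=> -[v|s]; rewrite [RHS]inE.
  by rewrite inE; apply/imsetP=> -[].
apply/imsetP/idP => [[u _ [->]]|Gs]; first exact: (valP u).
by exists (Sub s Gs).
Qed.

(** For [v] in the clique [s], whatever is adjacent to [s] is in the closed neighbourhood of [v]: a
    vertex completing [s], a clique containing [s], or a part of [s]. So [inl v] is a cone point. *)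
Lemma cyl_collapse_l :
  gcollapse (cyl_set setT (cliques G)) (cyl_set setT set0).
Proof.
pose U := cyl_set set0 (cliques G).
have <- : cyl_set setT (cliques G) :\: U = cyl_set setT set0.
  by apply/setP=> -[v|s]; rewrite !inE ?andNb.
apply: gcollapse_remove => [|B [v|s] sUB sBA]; rewrite ?inE //.
  by apply/subsetP=> -[v|s]; rewrite !inE.
case/andP=> /set0Pn[v sv] comp_s _.
apply: (@dism_cone _ _ (@gdom_anti cyl_graph) _ (inl v)).
  rewrite inE (subsetP sUB) ?inE // andbT /adj /=.
  by rewrite (setUidPr _) // sub1set.
move=> z _ _; apply/subsetP=> -[w|t] /setIP[_ /setIP[+ Bt]].
  rewrite inE /adj /= cyl_nbh_ll => /complete_subset-> //.
  by rewrite subUset !sub1set setU11 setU1r.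
rewrite inE cyl_nbh_lr /adj /= => /andP[_ /orP[st|ts]].
  have := subsetP sBA _ Bt; rewrite !inE => /andP[_ comp_t].
  by rewrite (setUidPr _) // sub1set (subsetP st).
by apply: complete_subset comp_s; rewrite subUset sub1set sv.
Qed.

Lemma cyl_collapse_r :
  gcollapse (cyl_set setT (cliques G)) (cyl_set set0 (cliques G)).
Proof.
pose V := cyl_set setT set0.
have <- : cyl_set setT (cliques G) :\: V = cyl_set set0 (cliques G).
  by apply/setP=> -[v|s]; rewrite !inE //= andbT.
apply: gcollapse_remove => [|B [v|s] sVB sBA]; rewrite ?inE //.
  by apply/subsetP=> -[v|s]; rewrite !inE.
move=> _ _; set A := _ :&: B.
(* Only vertices of [G] are deleted, so [B] still holds all cliques; in particular [v |: s] is at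
   hand. *)
have memAr (s : {set G}) :
    ((inr s : cyl_graph) \in A) = (s != set0) && complete_set (v |: s).
  rewrite in_setI inE /adj /=; apply/andP/andP => [[comp_vs Bs]|[s0 comp_vs]].
    by have := subsetP sBA _ Bs; rewrite !inE => /andP[].
  split=> //; apply: (subsetP sVB); rewrite !inE s0 /=.
  by apply: complete_subset comp_vs; apply: subsetUr.
have memAl (w : G) : (inl w : cyl_graph) \in A -> complete_set [set v; w].
  case/setIP=> + _; rewrite -cyl_nbh_ll mem_closed_nbh inE => ->.
  exact: orbT.
clearbody A.
pose f (a : cyl_graph) : cyl_graph := if a is inr s then inr (v |: s) else a.
pose mu (a : cyl_graph) := if a is inr s then #|s| else 0.
pose U : {set cyl_graph} :=
  [set a in A | if a is inr s then v \notin s else false].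
have memAU (a : cyl_graph) :
    (a \in A :\: U) = (a \in A) && (if a is inr s then v \in s else true).
  rewrite in_setD [_ \in U]inE negb_and andbC.
  by case: a => [w|s]; case: (_ \in A); rewrite ?negbK.
apply: (@dism_remove _ _ (@gdom_anti cyl_graph) f mu _ U).
- by apply/subsetP=> z /setIdP[].
- case=> [w|s] /setIdP[]//; rewrite /f memAU !memAr setU11 andbT.
  rewrite setUA setUid => /andP[_ ->] _; rewrite andbT.
  by apply/set0Pn; exists v; apply: setU11.
- case=> [w|s] /setIdP[]//; rewrite memAr => /andP[s0 comp_vs] vs.
  apply/subsetP=> -[w|t]; rewrite in_setI.
    rewrite !cyl_nbh_rl => /andP[comp_ws /setIdP[/memAl comp_vw _]].
    rewrite complete_setU1 comp_vs /= subUset; apply/andP; split.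
      by move: comp_vw; rewrite setUC complete_setU1 => /andP[].
    by move: comp_ws; rewrite complete_setU1 => /andP[].
  rewrite !cyl_nbh_rr => /andP[cmp_st /setIdP[At]].
  rewrite inE At /= negbK; exact: comparable_setU1.
apply: (@dism_cone _ _ (@gdom_anti cyl_graph) _ (inr [set v])).
  rewrite memAU memAr set11 setUid -cards_eq0 cards1 /= andbT.
  by have := cliques_vertex v; rewrite inE => /andP[].
move=> a _ _; apply/subsetP=> -[w|t] /setIP[_]; rewrite memAU => /andP[Aa va].
  by rewrite cyl_nbh_rl setUC memAl.
by rewrite cyl_nbh_rr sub1set va.
Qed.

Lemma same_s_face_graph :
  same_s_homotopy_type G (face_graph (clique_complex G)).
Proof.
have emb := graph_emb_val (cyl_set setT (cliques G)).
apply: same_s_trans (gcollapse_same cyl_collapse_r emb cyl_emb_r).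
exact: same_s_sym (gcollapse_same cyl_collapse_l emb cyl_emb_l).
Qed.

End GraphSubdivision.

(** * Deleting vertices from induced subcomplexes *)

Section FamilyRestriction.
Variables (T : finType) (W : {set {set T}}).
Hypothesis cW : is_complex W.

Definition frestr (C : {set T}) : {set {set T}} := [set s in W | s \subset C].

Lemma frestr_complex C : is_complex (frestr C).
Proof. by apply: is_complex_sep => // s t sC /subset_trans; apply. Qed.

Lemma fcollapse_remove (C U : {set T}) :
    U \subset C ->
    (forall (D : {set T}) v, C :\: U \subset D -> D \subset C ->
       v \in U -> v \in D ->
       dism (link_dom (frestr D) v) (link_vertices (frestr D) v)) ->
  fcollapse (frestr C) (frestr (C :\: U)).
Proof.
have [n] := ubnP #|U|; elim: n C U => // n IHn C U leUn sUC dismU.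
have [->|[v Uv]] := set_0Vmem U; first by rewrite setD0; apply: fcollapse_refl.
have Cv := subsetP sUC v Uv.
have eqCU := setD1D1 C Uv.
apply: (fcollapse_trans (F2 := frestr (C :\ v))).
  have -> : frestr (C :\ v) = [set s in frestr C | v \notin s].
    by apply/setP=> s; rewrite !inE subsetD1 andbA.
  apply: fcollapse_link (frestr_complex C) _.
  by apply: dismU => //; apply: subsetDl.
rewrite -eqCU; apply: IHn; first by move: leUn; rewrite (cardsD1 v) Uv.
  exact: setSD.
move=> D w; rewrite eqCU => sCUD sDC /setD1P[_ Uw] Dw; apply: dismU => //.
by apply: subset_trans sDC _; apply: subsetDl.
Qed.

End FamilyRestriction.

(** * The cylinder between a complex and its barycentric subdivision *)

Section ComplexSubdivision.
Variable K : scomplex.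
Implicit Types (z : {set K + {set K}}) (s t : {set K}).

Definition cyl_supp z : {set K} :=
  [set x | (inl x \in z) || [exists s, (inr s \in z) && (x \in s)]].

(* The disjoint unions of a set A of vertices and a chain c of simplices such *)
(* that A and the simplices in c lie in a common simplex of K.                *)
Definition cyl_family : {set {set K + {set K}}} :=
  [set z : {set K + {set K}} | [&& z != set0, cyl_supp z \in simplices K,
     [forall s, (inr s \in z) ==> (s != set0)] &
     [forall s, forall t,
        (inr s \in z) && (inr t \in z) ==> (s \subset t) || (t \subset s)]]].

Lemma cyl_suppP z x :
  reflect (inl x \in z \/ exists2 s, inr s \in z & x \in s) (x \in cyl_supp z).
Proof.
rewrite inE; apply: (iffP orP) => -[zx|]; try by left.
  by case/existsP=> s /andP[zs xs]; right; exists s.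
by case=> s zs xs; right; apply/existsP; exists s; rewrite zs.
Qed.

Lemma cyl_familyP z :
  reflect [/\ z != set0, cyl_supp z \in simplices K,
              forall s, inr s \in z -> s != set0 &
              forall s t, inr s \in z -> inr t \in z ->
                (s \subset t) || (t \subset s)]
          (z \in cyl_family).
Proof.
rewrite inE; apply: (iffP and4P) => -[z0 Kz nz cmp]; split=> //.
- by move=> s zs; have /forallP/(_ s) := nz; rewrite zs.
- by move=> s t zs zt; have /forallP/(_ s)/forallP/(_ t) := cmp; rewrite zs zt.
- by apply/forallP=> s; apply/implyP; apply: nz.
apply/forallP=> s; apply/forallP=> t; apply/implyP=> /andP[].
exact: cmp.
Qed.

Lemma sub_cyl_supp z s : inr s \in z -> s \subset cyl_supp z.
Proof.
by move=> zs; apply/subsetP=> x xs; apply/cyl_suppP; right; exists s.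
Qed.

Lemma cyl_suppS z z' : z \subset z' -> cyl_supp z \subset cyl_supp z'.
Proof.
move=> /subsetP szz'; apply/subsetP=> x /cyl_suppP[zx|[s zs xs]].
  by apply/cyl_suppP; left; apply: szz'.
by apply/cyl_suppP; right; exists s; rewrite ?szz'.
Qed.

Lemma cyl_supp_neq0 z :
  z != set0 -> (forall s, inr s \in z -> s != set0) -> cyl_supp z != set0.
Proof.
case/set0Pn=> [[x|s] za] nz; apply/set0Pn.
  by exists x; apply/cyl_suppP; left.
have /set0Pn[x xs] := nz s za.
by exists x; apply/cyl_suppP; right; exists s.
Qed.

Lemma cyl_family_complex : is_complex cyl_family.
Proof.
split=> [|z z' /cyl_familyP[z0 Kz nz cmp] z'0 sz'z].
  by apply/negP=> /cyl_familyP[]; rewrite eqxx.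
have nz' s : inr s \in z' -> s != set0 by move/(subsetP sz'z); apply: nz.
apply/cyl_familyP; split=> // [|s t /(subsetP sz'z) zs /(subsetP sz'z) zt].
  exact: simplex_sub Kz (cyl_supp_neq0 z'0 nz') (cyl_suppS sz'z).
exact: cmp.
Qed.

Lemma cyl_supp_addl z x : cyl_supp (inl x |: z) = x |: cyl_supp z.
Proof.
apply/setP=> y; apply/cyl_suppP/setU1P.
  case=> [/setU1P[[->]|zy]|[s /setU1P[//|zs] ys]]; first by left.
    by right; apply/cyl_suppP; left.
  by right; apply/cyl_suppP; right; exists s.
case=> [->|/cyl_suppP[zy|[s zs ys]]]; first by left; apply: setU11.
  by left; apply: setU1r.
by right; exists s => //; apply: setU1r.
Qed.

Lemma cyl_supp_addr z t : cyl_supp (inr t |: z) = t :|: cyl_supp z.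
Proof.
apply/setP=> y; apply/cyl_suppP/setUP.
  case=> [/setU1P[//|zy]|[s /setU1P[[->]|zs] ys]]; last 2 first.
  - by left.
  - by right; apply/cyl_suppP; right; exists s.
  by right; apply/cyl_suppP; left.
case=> [yt|/cyl_suppP[zy|[s zs ys]]].
- by right; exists t => //; apply: setU11.
- by left; apply: setU1r.
by right; exists s => //; apply: setU1r.
Qed.

(** A point of the support leaves the support unchanged, so the latter is still a simplex of [K].
    The next lemma is the analogue for a simplex inside the support, with the chain condition
    added. *)
Lemma cyl_family_addl z x :
  z \in cyl_family -> x \in cyl_supp z -> inl x |: z \in cyl_family.
Proof.
move=> /cyl_familyP[z0 Kz nz cmp] zx; apply/cyl_familyP; split.
- by apply/set0Pn; exists (inl x); apply: setU11.
- by rewrite cyl_supp_addl (setUidPr _) // sub1set.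
- by move=> s /setU1P[//|]; apply: nz.
by move=> s t /setU1P[//|zs] /setU1P[//|zt]; apply: cmp.
Qed.

Lemma cyl_family_addr z s :
    z \in cyl_family -> s != set0 -> s \subset cyl_supp z ->
    (forall t, inr t \in z -> (s \subset t) || (t \subset s)) ->
  inr s |: z \in cyl_family.
Proof.
move=> /cyl_familyP[z0 Kz nz cmp] s0 sz cmp_s; apply/cyl_familyP; split.
- by apply/set0Pn; exists (inr s); apply: setU11.
- by rewrite cyl_supp_addr (setUidPr _).
- by move=> t /setU1P[[->]|] //; apply: nz.
move=> t u /setU1P[[->]|zt] /setU1P[[->]|zu]; rewrite ?subxx //.
- exact: cmp_s.
- by rewrite orbC; apply: cmp_s.
exact: cmp.
Qed.

Lemma cyl_family_pair x s :
  ([set inl x; inr s] \in cyl_family) = (s != set0) && (x |: s \in simplices K).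
Proof.
have supp0 : cyl_supp set0 = set0.
  by apply/setP=> y; rewrite in_set0; apply/cyl_suppP=> -[|[t]]; rewrite inE.
have supp_xs : cyl_supp [set inl x; inr s] = x |: s.
  by rewrite cyl_supp_addl -[[set inr s]]setU0 cyl_supp_addr supp0 setU0.
apply/cyl_familyP/andP => [[_ + nz _]|[s0 Kxs]].
  by rewrite supp_xs => ->; rewrite nz // set22.
split; rewrite ?supp_xs //.
- by apply/set0Pn; exists (inl x); apply: setU11.
- by move=> t /set2P[//|[->]].
by move=> t u /set2P[//|[->]] /set2P[//|[->]]; rewrite subxx.
Qed.

Local Notation ccyl X S := (frestr cyl_family (sum_set X S)).

Lemma ccyl_emb_l : complex_emb (inl : K -> K + {set K}) (ccyl setT set0).
Proof.
have inl_inj : injective (inl : K -> K + {set K}) by move=> x y [].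
have supp_inl s : cyl_supp (inl @: s) = s.
  apply/setP=> x; apply/cyl_suppP/idP => [[|[t /imsetP[]//]]|xs].
    by rewrite mem_imset.
  by left; apply: imset_f.
split=> //; apply/setP=> z; apply/imsetP/setIdP.
  case=> s Ks ->; split.
    apply/cyl_familyP; split; first 1 last.
    - by rewrite supp_inl.
    - by move=> t /imsetP[].
    - by move=> t u /imsetP[].
    rewrite imset_eq0; apply: contraTneq Ks => ->.
    exact: simplex_neq0.
  by apply/subsetP=> _ /imsetP[x _ ->]; rewrite !inE.
case=> /cyl_familyP[z0 Kz _ _] /subsetP zC.
exists (cyl_supp z) => //; apply/setP=> -[x|s]; apply/idP/imsetP.
- by move=> zx; exists x => //; apply/cyl_suppP; left.
- by case=> y /cyl_suppP[zy [->]//|[s /zC]]; rewrite inE inE.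
- by move=> /zC; rewrite inE inE.
by case.
Qed.

(** The faces made of simplices alone are the chains of simplices, that is, the cliques of the face
    graph. *)
Lemma ccyl_emb_r :
  complex_emb
    ((fun u => inr (val u)) : clique_complex (face_graph K) -> K + {set K})
    (ccyl set0 (simplices K)).
Proof.
pose g (u : face_graph K) : K + {set K} := inr (val u).
have g_inj : injective g by move=> u w [/val_inj].
split=> //; apply/setP=> z; apply/imsetP/setIdP.
  case=> c; rewrite inE => /andP[c0 /complete_setP comp_c] ->.
  have cmp_c (u w : face_graph K) : u \in c -> w \in c ->
      (val u \subset val w) || (val w \subset val u).
    move=> cu cw; have := comp_c u w cu cw; rewrite /adj /= /face_adj.
    by case: eqP => [->|] //=; rewrite subxx.
  split; last first.
    by apply/subsetP=> _ /imsetP[u _ ->]; rewrite inE; apply: valP.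
  apply/cyl_familyP; split.
  - by rewrite imset_eq0.
  - have [u0 cu0] := set0Pn _ c0.
    (* The support of a chain is its largest member, hence a simplex of [K]. *)
    case: (@arg_maxnP _ u0 (mem c) (fun u => #|val u|) cu0) => u cu umax.
    rewrite (_ : cyl_supp _ = val u); first exact: valP.
    apply/eqP; rewrite eqEsubset sub_cyl_supp ?imset_f // andbT.
    apply/subsetP=> x /cyl_suppP[/imsetP[]//|[s /imsetP[w cw [->]] xw]].
    have /orP[uw|/subsetP->//] := cmp_c u w cu cw.
    have /eqP eq_uw : val u == val w by rewrite eqEcard uw; apply: umax.
    by move: xw; rewrite /= -eq_uw.
  - move=> s /imsetP[u _ [->]]; apply: contraTneq (valP u) => /= ->.
    exact: simplex_neq0.
  by move=> s t /imsetP[u cu [->]] /imsetP[w cw [->]]; apply: cmp_c.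
case=> /cyl_familyP[z0 Kz nz cmp] /subsetP zC.
have def_z : z = g @: (g @^-1: z).
  apply/setP=> a; apply/idP/imsetP => [za|[u + ->]]; last by rewrite inE.
  have := zC a za; case: a za => [x|s] zs; rewrite inE ?inE // => Ks.
  by exists (Sub s Ks); rewrite // inE.
exists (g @^-1: z) => //; rewrite inE; apply/andP; split.
  by apply: contraNneq z0 => z'0; rewrite def_z z'0 imset0.
apply/complete_setP=> u w; rewrite !inE => zu zw.
by rewrite /adj /= /face_adj (cmp _ _ zu zw) andbT orbN.
Qed.

(** If [v] is in [s], any face containing [inr s] has [v] in its support and accepts [inl v]; the
    link of [inr s] is thus a cone. *)
Lemma ccyl_collapse_l :
  fcollapse (ccyl setT (simplices K)) (ccyl setT set0).
Proof.
pose U : {set K + {set K}} := sum_set set0 (simplices K).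
have <- : sum_set setT (simplices K) :\: U = sum_set setT set0.
  by apply/setP=> -[v|s]; rewrite !inE ?andNb.
apply: (fcollapse_remove cyl_family_complex) => [|D [v|s] sUD sDC].
- by apply/subsetP=> -[v|s]; rewrite !inE.
- by rewrite !inE.
rewrite inE => Ks Ds.
have s0 : s != set0 by apply: contraTneq Ks => ->; apply: simplex_neq0.
have /set0Pn[v sv] := s0.
have Dv : inl v \in D by rewrite (subsetP sUD) ?inE.
apply: (@dism_cone _ _ (@link_dom_anti _ _ _) _ (inl v)).
  rewrite in_set /= in_set (setUC [set inr s]) cyl_family_pair s0.
  by rewrite (setUidPr _) ?sub1set // Ks subUset !sub1set Dv Ds.
move=> a _ _ z /setIdP[Wz zD] zs za zA; apply/setIdP; split.
  apply: cyl_family_addl => //; exact: (subsetP (sub_cyl_supp zs)).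
by rewrite subUset sub1set Dv.
Qed.

(** A face containing [inl v] and [inr s] has [v |: s] inside its support, so adding [inr (v |: s)]
    can only break the chain condition; removing larger [s] first prevents this, by
    [comparable_setU1]. *)
Lemma ccyl_collapse_r :
  fcollapse (ccyl setT (simplices K)) (ccyl set0 (simplices K)).
Proof.
pose V : {set K + {set K}} := sum_set setT set0.
have <- : sum_set setT (simplices K) :\: V = sum_set set0 (simplices K).
  by apply/setP=> -[v|s]; rewrite !inE //= andbT.
apply: (fcollapse_remove cyl_family_complex) => [|D [v|s] sVD sDC];
  [by apply/subsetP=> -[v|s]; rewrite !inE | | by rewrite inE inE].
move=> _ Dv; set A := link_vertices _ _.
have Dr s : s \in simplices K -> inr s \in D.
  by move=> Ks; rewrite (subsetP sVD) // !inE.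
have memAr s : (inr s \in A) = (s != set0) && (v |: s \in simplices K).
  rewrite in_set /= inE cyl_family_pair; case: eqP => //= /eqP s0.
  case Kvs: (_ \in _) => //=; rewrite subUset !sub1set Dv Dr //.
  exact: simplex_sub Kvs s0 (subsetUr _ _).
clearbody A.
pose f (a : K + {set K}) : K + {set K} :=
  if a is inr s then inr (v |: s) else a.
pose mu (a : K + {set K}) := if a is inr s then #|s| else 0.
pose U : {set K + {set K}} :=
  [set a in A | if a is inr s then v \notin s else false].
have memAU a :
    (a \in A :\: U) = (a \in A) && (if a is inr s then v \in s else true).
  rewrite in_setD [_ \in U]inE negb_and andbC.
  by case: a => [w|s]; case: (_ \in A); rewrite ?negbK.
have supp_v z : inl v \in z -> v \in cyl_supp z.
  by move=> zv; apply/cyl_suppP; left.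
apply: (@dism_remove _ _ (@link_dom_anti _ _ _) f mu _ U).
- by apply/subsetP=> a /setIdP[].
- case=> [w|s] /setIdP[]//; rewrite /f memAU !memAr setU11 andbT.
  rewrite setUA setUid => /andP[_ ->] _; rewrite andbT.
  by apply/set0Pn; exists v; apply: setU11.
- case=> [w|s] /setIdP[]//; rewrite memAr => /andP[s0 Kvs] vs.
  move=> z /setIdP[Wz zD] zv zs /subsetP zA; apply/setIdP; split; last first.
    by rewrite subUset sub1set Dr.
  apply: cyl_family_addr => //.
  - by apply/set0Pn; exists v; apply: setU11.
  - by rewrite subUset sub1set supp_v //= sub_cyl_supp.
  move=> t zt; apply: comparable_setU1.
    by have /cyl_familyP[_ _ _] := Wz; apply.
  have := zA _ zt; rewrite !inE /= => /andP[At].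
  by rewrite At /= negbK.
(* All simplices left contain [v], so [[set v]] extends every chain of them, and the support is
   again unchanged. *)
apply: (@dism_cone _ _ (@link_dom_anti _ _ _) _ (inr [set v])).
  rewrite memAU memAr set11 setUid -cards_eq0 cards1 /= andbT.
  exact: simplex_vertex.
move=> a _ _ z /setIdP[Wz zD] zv za /subsetP zA; apply/setIdP.
split; last first.
  by rewrite subUset sub1set Dr ?simplex_vertex.
apply: cyl_family_addr => //.
- by rewrite -cards_eq0 cards1.
- by rewrite sub1set supp_v.
move=> t /zA /setU1P[//|]; rewrite memAU sub1set => /andP[_ ->].
by [].
Qed.

Lemma same_simple_clique_complex :
  same_simple_homotopy_type K (clique_complex (face_graph K)).
Proof.
have [M [f emb]] := complex_emb_exists
  (frestr_complex cyl_family_complex (sum_set setT (simplices K))).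
apply: same_simple_trans (fcollapse_same ccyl_collapse_r emb ccyl_emb_r).
exact: same_simple_sym (fcollapse_same ccyl_collapse_l emb ccyl_emb_l).
Qed.

End ComplexSubdivision.

Theorem theorem2p10 :
  (forall G H : sgraph,
     same_s_homotopy_type G H <->
     same_simple_homotopy_type (clique_complex G) (clique_complex H)) /\
  (forall K L : scomplex,
     same_simple_homotopy_type K L <->
     same_s_homotopy_type (face_graph K) (face_graph L)).
Proof.
have cliqueP G H : same_s_homotopy_type G H ->
    same_simple_homotopy_type (clique_complex G) (clique_complex H).
  elim=> [{}G {}H isoGH|{}G J {}H stepGJ _]; last first.
    apply: same_simple_trans; case: stepGJ => /s_deletion_clique_complex //.
    exact: same_simple_sym.
  have [f embf] := iso_emb isoGH; apply: simple_homotopy_iso.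
  exact: complex_emb_iso (clique_complex_emb embf)
    (clique_complex_emb (emb_id H)).
have faceP K L : same_simple_homotopy_type K L ->
    same_s_homotopy_type (face_graph K) (face_graph L).
  elim=> [{}K {}L isoKL|{}K M {}L stepKM _]; last first.
    apply: same_s_trans; case: stepKM => /elementary_collapse_face_graph //.
    exact: same_s_sym.
  have [f embf] := iso_complex_emb isoKL; apply: s_homotopy_iso.
  exact: emb_iso (face_graph_emb embf) (face_graph_emb (complex_emb_id L)).
split=> [G H|K L]; split; [exact: cliqueP| |exact: faceP|].
  (* The forward implication for complexes is applied to the two clique complexes, and the cylinders
     bring the result back to [G] and [H]. *)
  move/faceP=> sGH; apply: same_s_trans (same_s_face_graph G) _.
  exact: same_s_trans sGH (same_s_sym (same_s_face_graph H)).
move/cliqueP=> sKL; apply: same_simple_trans (same_simple_clique_complex K) _.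
exact: same_simple_trans sKL (same_simple_sym (same_simple_clique_complex L)).
Qed.
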